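(* The following two statements are equivalent: (i) for every finite simple graph $G$, $\eta(G) \ge \chi(G)$; (ii) for every finite simple split graph $H$, $\eta(H^2) \ge \chi(H^2)$.
   Context: All graphs are finite, undirected and simple. $\chi(G)$ denotes the chromatic number of $G$. A graph $M$ is a minor of $G$ if a graph isomorphic to $M$ can be obtained from a subgraph of $G$ by contracting edges; the Hadwiger number $\eta(G)$ is the largest integer $t$ such that $G$ has a minor isomorphic to the complete graph $K_t$. A split graph is a graph whose vertex set can be partitioned into an independent set and a clique. The square $G^2$ of a graph $G$ is the graph on $V(G)$ in which two distinct vertices are adjacent if and only if their distance in $G$ is $1$ or $2$. (Statement (i) is Hadwiger's conjecture.) *)

(* Defs.v *)
From HB Require Import structures.
From mathcomp Require Import all_boot.
From mathcomp Require Import boolp.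

Set Implicit Arguments.
Unset Strict Implicit.
Unset Printing Implicit Defensive.

Record sgraph := SGraph {
  svertex :> finType;
  sedge : rel svertex;
  sedge_sym : symmetric sedge;
  sedge_irrefl : irreflexive sedge
}.

Notation "x -- y" := (sedge x y) (at level 30).

Definition sg_iso (G H : sgraph) : Prop :=
  exists f : G -> H, bijective f /\ forall x y : G, (f x -- f y) = (x -- y).

Definition complete_rel (n : nat) : rel 'I_n := fun i j => i != j.

Lemma complete_sym n : symmetric (@complete_rel n).
Proof. by move=> i j; rewrite /complete_rel eq_sym. Qed.

Lemma complete_irrefl n : irreflexive (@complete_rel n).
Proof. by move=> i; rewrite /complete_rel eqxx. Qed.

Definition complete (n : nat) : sgraph :=
  SGraph (@complete_sym n) (@complete_irrefl n).

Definition proper_coloring (G : sgraph) (k : nat) (f : {ffun G -> 'I_k}) : bool :=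
  [forall x, forall y, (x -- y) ==> (f x != f y)].

Definition colorable (G : sgraph) (k : nat) : bool :=
  [exists f : {ffun G -> 'I_k}, proper_coloring f].

Lemma ex_colorable (G : sgraph) : exists k, colorable G k.
Proof.
exists #|G|; apply/existsP; exists [ffun x => enum_rank x].
apply/forallP => x; apply/forallP => y; apply/implyP => xy; rewrite !ffunE.
by apply/eqP => /enum_rank_inj eq_xy; rewrite eq_xy sedge_irrefl in xy.
Qed.

Definition chromatic_number (G : sgraph) : nat := ex_minn (ex_colorable G).

(* Pairs of [sub_edge] outside [sub_verts] are discarded by [graph_of_subgraph]. *)
Record subgraph (G : sgraph) := Subgraph {
  sub_verts : {set G};
  sub_edge : rel G;
  sub_edge_sym : symmetric sub_edge;
  sub_edge_sub : subrel sub_edge (@sedge G)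
}.

Section SubgraphToGraph.
Variables (G : sgraph) (S : subgraph G).

Definition graph_of_subgraph_rel : rel {x : G | x \in sub_verts S} :=
  fun u v => sub_edge S (val u) (val v).

Lemma graph_of_subgraph_sym : symmetric graph_of_subgraph_rel.
Proof. by move=> u v; apply: sub_edge_sym. Qed.

Lemma graph_of_subgraph_irrefl : irreflexive graph_of_subgraph_rel.
Proof.
move=> u; apply/negbTE/negP => /sub_edge_sub.
by rewrite sedge_irrefl.
Qed.

Definition graph_of_subgraph : sgraph :=
  SGraph graph_of_subgraph_sym graph_of_subgraph_irrefl.

End SubgraphToGraph.

(* [None] is the vertex that replaces both [x] and [y]; only meaningful when   *)
(* [x -- y], which [contracts] requires.                                       *)
Section Contract.
Variables (G : sgraph) (x y : G).

Definition contract_rel : rel (option {z : G | z \notin [set x; y]}) :=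
  fun u v => match u, v with
  | Some a, Some b => val a -- val b
  | Some a, None => (val a -- x) || (val a -- y)
  | None, Some b => (val b -- x) || (val b -- y)
  | None, None => false
  end.

Lemma contract_sym : symmetric contract_rel.
Proof. by move=> [u|] [v|] //=; rewrite sedge_sym. Qed.

Lemma contract_irrefl : irreflexive contract_rel.
Proof. by move=> [u|] //=; rewrite sedge_irrefl. Qed.

Definition contract : sgraph := SGraph contract_sym contract_irrefl.

End Contract.

Inductive contracts (G : sgraph) : sgraph -> Prop :=
| contracts_refl : contracts G G
| contracts_step (H : sgraph) (x y : H) :
    contracts G H -> x -- y -> contracts G (contract x y).

Definition minor (M G : sgraph) : Prop :=
  exists (S : subgraph G) (H : sgraph),
    contracts (graph_of_subgraph S) H /\ sg_iso H M.

Lemma ex_complete_minor (G : sgraph) : exists t, `[< minor (complete t) G >].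
Proof.
exists 0; apply/asboolP.
have F_sym : symmetric (fun _ _ : G => false) by [].
have F_sub : subrel (fun _ _ : G => false) (@sedge G) by [].
pose S := @Subgraph G set0 _ F_sym F_sub.
exists S, (graph_of_subgraph S); split; first exact: contracts_refl.
have no (u : graph_of_subgraph S) : False by case: u => u /=; rewrite inE.
exists (fun u => False_rect 'I_0 (no u)); split; last by move=> u; case: (no u).
by exists (fun i : 'I_0 => False_rect _ (notF (ltn_ord i))) => [u|[]//]; case: (no u).
Qed.

Lemma contracts_card (G H : sgraph) : contracts G H -> #|H| <= #|G|.
Proof.
elim=> // {}H x y _ leHG xy; apply: leq_trans leHG.
have neq_xy : x != y by apply: contraTneq xy => ->; rewrite sedge_irrefl.
rewrite /= card_option card_sig -(cardC [in [set x; y]]) cards2 neq_xy.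
by rewrite addSn add1n ltnS leqW.
Qed.

Lemma complete_minor_bound (G : sgraph) (t : nat) :
  `[< minor (complete t) G >] -> t <= #|G|.
Proof.
move/asboolP=> [S [H [/contracts_card leHS [f [bij_f _]]]]].
rewrite -[t]card_ord -(bij_eq_card bij_f); apply: leq_trans leHS _.
by rewrite /= card_sig max_card.
Qed.

Definition hadwiger_number (G : sgraph) : nat :=
  ex_maxn (ex_complete_minor G) (@complete_minor_bound G).

Definition independent (G : sgraph) (A : {set G}) : Prop :=
  forall x y, x \in A -> y \in A -> ~~ (x -- y).

Definition clique (G : sgraph) (A : {set G}) : Prop :=
  forall x y, x \in A -> y \in A -> x != y -> x -- y.

Definition split_graph (G : sgraph) : Prop :=
  exists A : {set G}, independent A /\ clique (~: A).

Definition walk_of_length (G : sgraph) (d : nat) (x y : G) : bool :=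
  [exists p : d.-tuple G, path (@sedge G) x p && (last x p == y)].

Definition at_distance (G : sgraph) (d : nat) (x y : G) : bool :=
  walk_of_length d x y && [forall j : 'I_d, ~~ walk_of_length j x y].

Definition square_rel (G : sgraph) : rel G :=
  fun x y => (x != y) && (at_distance 1 x y || at_distance 2 x y).

Lemma walk_of_length_sym (G : sgraph) d : symmetric (@walk_of_length G d).
Proof.
have half (x y : G) : walk_of_length d x y -> walk_of_length d y x.
  case/existsP => p /andP[px /eqP <-].
  have sz : size (rev (belast x p)) == d by rewrite size_rev size_belast size_tuple.
  apply/existsP; exists (Tuple sz); rewrite /= rev_path.
  rewrite (eq_path (e' := @sedge G)) ?px; last by move=> u v; rewrite sedge_sym.
  by case: (val p) => //= a s; rewrite rev_cons last_rcons eqxx.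
by move=> x y; apply/idP/idP; apply: half.
Qed.

Lemma square_sym (G : sgraph) : symmetric (@square_rel G).
Proof.
have dsym d : symmetric (@at_distance G d).
  move=> x y; rewrite /at_distance walk_of_length_sym; congr (_ && _).
  by apply: eq_forallb => j; rewrite walk_of_length_sym.
by move=> x y; rewrite /square_rel eq_sym (dsym 1) (dsym 2).
Qed.

Lemma square_irrefl (G : sgraph) : irreflexive (@square_rel G).
Proof. by move=> x; rewrite /square_rel eqxx. Qed.

Definition square (G : sgraph) : sgraph :=
  SGraph (@square_sym G) (@square_irrefl G).

(* Main.v *)
(* Given [G], let [H] be the split graph with independent part [V(G)] and
   clique part [V(G) * V(G)], where [x] is joined to the pair [(a, b)] when
   [x] is [a] or [b] and [a], [b] are equal or adjacent.  Distinct vertices of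
   [G] have a common neighbour in [H] exactly when they are adjacent in [G],
   and each [x] has the neighbour [(x, x)], so [H^2] is the join of [G] with a
   clique on [m = |V(G)|^2] vertices.  Universal vertices need colours of their
   own, so joining [m] of them raises the chromatic number by at least [m];
   each deleted vertex lies in at most one branch set of a clique minor, so
   deleting [m] vertices lowers the Hadwiger number by at most [m]. *)
Require Import Defs.
From mathcomp Require Import all_boot.
From mathcomp Require Import boolp.

Set Implicit Arguments.
Unset Strict Implicit.
Unset Printing Implicit Defensive.

(** * Connected sets *)

Definition edge_in (G : sgraph) (A : {set G}) : rel G :=
  [rel x y | [&& x \in A, y \in A & x -- y]].

Definition connected (G : sgraph) (A : {set G}) : Prop :=
  {in A &, forall x y, connect (edge_in A) x y}.

Definition adjacent_fibres (G : sgraph) (T : Type) (f : G -> T)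
    (s t : T) : Prop :=
  exists x y, [/\ f x = s, f y = t & x -- y].

Lemma connect_edge_in_sub (G : sgraph) (A B : {set G}) :
  A \subset B -> subrel (connect (edge_in A)) (connect (edge_in B)).
Proof.
move=> /subsetP sAB; apply: connect_sub => x y /and3P[xA yA xy].
by apply: connect1; rewrite /edge_in /= !sAB.
Qed.

Lemma clique_connected (G : sgraph) (A : {set G}) : clique A -> connected A.
Proof.
move=> A_clique x y xA yA; have [->|neq_xy] := eqVneq x y.
  exact: connect0.
by apply: connect1; rewrite /edge_in /= xA yA A_clique.
Qed.

Lemma connected_fibre_inj (G : sgraph) (T : finType) (f : G -> T) (t : T) :
  injective f -> connected (f @^-1: [set t]).
Proof.
move=> f_inj; apply: clique_connected => x y.
by rewrite !inE => /eqP <- /eqP/f_inj ->; rewrite eqxx.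
Qed.

Lemma homo_connect (S T : finType) (e : rel S) (e' : rel T) (h : S -> T) :
  {homo h : x y / e x y >-> connect e' x y} ->
  {homo h : x y / connect e x y >-> connect e' x y}.
Proof.
move=> h_homo x y /connectP[p]; elim: p x => [|z p IHp] x /=.
  by move=> _ ->; apply: connect0.
by case/andP=> /h_homo xz zp /(IHp z zp); apply: connect_trans.
Qed.

Lemma connected_imset (G K : sgraph) (h : G -> K) (A : {set G}) :
  (forall x y, x -- y -> h x = h y \/ h x -- h y) ->
  connected A -> connected (h @: A).
Proof.
move=> h_edge A_conn _ _ /imsetP[x xA ->] /imsetP[y yA ->].
apply: homo_connect (A_conn x y xA yA) => {xA yA}x {}y /and3P[xA yA xy].
have [->|hxy] := h_edge x y xy; first exact: connect0.
by apply: connect1; rewrite /edge_in /= !imset_f.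
Qed.

Lemma connected_preimset (G K : sgraph) (h : G -> K) (A : {set K}) :
  {in A, forall u, connected (h @^-1: [set u])} ->
  {in A &, forall u v, u -- v -> adjacent_fibres h u v} ->
  connected A -> connected (h @^-1: A).
Proof.
move=> fibre_conn edge_lift A_conn x y; rewrite !inE => hxA hyA.
have same_fibre a b :
    h a \in A -> h a = h b -> connect (edge_in (h @^-1: A)) a b.
  move=> haA hab; apply: connect_edge_in_sub (fibre_conn _ haA a b _ _).
  - by apply: preimsetS; rewrite sub1set.
  - by rewrite !inE.
  - by rewrite !inE hab.
have /connectP[p] := A_conn _ _ hxA hyA.
elim: p x hxA => [|w p IHp] x hxA /=.
  by move=> _ /esym; apply: same_fibre.
case/andP=> /and3P[_ wA xw] wp eq_y.
have [a [b [ha hb ab]]] := edge_lift _ _ hxA wA xw.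
apply: connect_trans (same_fibre x a hxA (esym ha)) _.
apply: (@connect_trans _ _ b); last by apply: IHp; rewrite hb.
by apply: connect1; rewrite /edge_in /= !inE ha hb hxA wA.
Qed.

(** * Contraction maps *)

Definition contraction_map (G H : sgraph) (f : G -> H) : Prop :=
  [/\ forall u, exists x, f x = u,
      forall u, connected (f @^-1: [set u]),
      forall x y, x -- y -> f x = f y \/ f x -- f y &
      forall u v, u -- v -> adjacent_fibres f u v].

Lemma bijective_contraction_map (G H : sgraph) (f : G -> H) :
  bijective f -> {mono f : x y / x -- y >-> x -- y} -> contraction_map f.
Proof.
move=> f_bij f_mono; have [g fK gK] := f_bij.
split=> [u|u|x y xy|u v uv].
- by exists (g u).
- exact/connected_fibre_inj/bij_inj.
- by right; rewrite f_mono.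
- by exists (g u), (g v); rewrite -f_mono !gK.
Qed.

Lemma injective_contraction_map_iso (G H : sgraph) (f : G -> H) :
  contraction_map f -> injective f -> sg_iso G H.
Proof.
move=> [f_surj _ f_edge f_lift] f_inj; exists f; split=> [|x y].
  have [g gK] := fin_all_exists f_surj.
  by exists g => // x; apply: f_inj.
apply/idP/idP => [/f_lift[a [b [/f_inj -> /f_inj -> //]]]|xy].
by case: (f_edge x y xy) => // /f_inj eq_xy; rewrite eq_xy sedge_irrefl in xy.
Qed.

Lemma contraction_map_comp (G H K : sgraph) (f : G -> H) (g : H -> K) :
  contraction_map f -> contraction_map g -> contraction_map (g \o f).
Proof.
move=> [f_surj f_conn f_edge f_lift] [g_surj g_conn g_edge g_lift].
split=> [w|w|x y /f_edge[/= ->|/g_edge //]|w z].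
- by have [u <-] := g_surj w; have [x <-] := f_surj u; exists x.
- have -> : (g \o f) @^-1: [set w] = f @^-1: (g @^-1: [set w]).
    by apply/setP=> x; rewrite !inE.
  by apply: connected_preimset => // u v _ _; apply: f_lift.
- by left.
- by case/g_lift=> _ [_ [<- <- /f_lift[x [y [<- <- xy]]]]]; exists x, y.
Qed.

Lemma contraction_map_factor (G H K : sgraph) (f : G -> H) (g : H -> K) :
  contraction_map f -> contraction_map (g \o f) -> contraction_map g.
Proof.
move=> [f_surj _ f_edge f_lift] [gf_surj gf_conn gf_edge gf_lift].
split=> [w|w|u v|w z].
- by have [x <-] := gf_surj w; exists (f x).
- have -> : g @^-1: [set w] = f @: ((g \o f) @^-1: [set w]).
    apply/setP=> u; apply/idP/imsetP => [|[x + ->]]; last by rewrite !inE.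
    by have [x <-] := f_surj u; rewrite !inE => gfx; exists x; rewrite ?inE.
  exact: connected_imset f_edge (gf_conn w).
- by case/f_lift=> x [y [<- <- /gf_edge]].
- move=> wz; have [x [y [gfx gfy xy]]] := gf_lift w z wz.
  exists (f x), (f y); split=> //; case: (f_edge x y xy) => // eq_f.
  by rewrite -gfx -gfy /= eq_f sedge_irrefl in wz.
Qed.

Lemma contraction_map_collapse (G H : sgraph) (f : G -> H) :
  contraction_map f -> ~ injective f -> exists x y, x -- y /\ f x = f y.
Proof.
move=> [_ f_conn _ _] /injectiveP/injectivePn[x [y neq_xy eq_f]].
have /connectP[[|z p] /=] : connect (edge_in (f @^-1: [set f x])) x y.
- by apply: f_conn; rewrite !inE // eq_f.
- by move=> _ eq_yx; rewrite eq_yx eqxx in neq_xy.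
- by case/andP=> /and3P[_]; rewrite !inE => /eqP fz xz _ _; exists x, z.
Qed.

Section ContractMap.
Variables (G : sgraph) (x y : G).

Definition contract_map (z : G) : contract x y := insub z.

Lemma contract_map_val (u : {z : G | z \notin [set x; y]}) :
  contract_map (val u) = Some u.
Proof. exact: valK. Qed.

Lemma contract_map_None (z : G) : z \in [set x; y] -> contract_map z = None.
Proof. by move=> zxy; rewrite /contract_map insubN // negbK. Qed.

Lemma contract_map_surj (u : contract x y) : exists z, contract_map z = u.
Proof.
case: u => [u|]; first by exists (val u); apply: contract_map_val.
by exists x; rewrite contract_map_None ?set21.
Qed.

Lemma connected_fibre_contract_map (u : contract x y) :
  x -- y -> connected (contract_map @^-1: [set u]).
Proof.
move=> xy; apply: clique_connected => a b; rewrite !inE /contract_map.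
case: insubP => [a' _ <-|/negPn a_xy] /eqP <-;
  case: insubP => [b' _ <-|/negPn b_xy] //.
  by move=> /eqP[->]; rewrite eqxx.
move: a_xy b_xy; rewrite !inE => /orP[]/eqP -> /orP[]/eqP ->; rewrite ?eqxx //.
by rewrite sedge_sym.
Qed.

Lemma contract_map_edge (a b : G) :
  a -- b -> contract_map a = contract_map b \/ contract_map a -- contract_map b.
Proof.
move=> ab; rewrite /contract_map.
case: insubP => [u _ ua|/negPn aN]; case: insubP => [v _ vb|/negPn bN].
- by right; rewrite /= ua vb.
- by right; move: bN; rewrite /= ua !inE => /orP[]/eqP <-; rewrite ab ?orbT.
- right; move: aN; rewrite /= vb !inE (sedge_sym b x) (sedge_sym b y).
  by move=> /orP[]/eqP <-; rewrite ab ?orbT.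
- by left.
Qed.

Lemma contract_edge_lift (u v : contract x y) :
  u -- v -> adjacent_fibres contract_map u v.
Proof.
have mapx : contract_map x = None by rewrite contract_map_None ?set21.
have mapy : contract_map y = None by rewrite contract_map_None ?set22.
case: u => [u|]; case: v => [v|] //=.
- by move=> uv; exists (val u), (val v); rewrite !contract_map_val.
- by case/orP=> uv; [exists (val u), x | exists (val u), y];
    rewrite contract_map_val.
- rewrite !(sedge_sym (val v)).
  by case/orP=> uv; [exists x, (val v) | exists y, (val v)];
    rewrite contract_map_val.
Qed.

Lemma contract_contraction_map : x -- y -> contraction_map contract_map.
Proof.
split.
- exact: contract_map_surj.
- by move=> u; apply: connected_fibre_contract_map.
- exact: contract_map_edge.
- exact: contract_edge_lift.
Qed.

Lemma card_contract : x -- y -> #|contract x y| < #|G|.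
Proof.
move=> xy; rewrite /= card_option card_sig -(cardC [in [set x; y]]) cards2.
have -> : x != y by apply: contraTneq xy => ->; rewrite sedge_irrefl.
by rewrite addSn add1n.
Qed.

End ContractMap.

Lemma contracts_contraction_map (G H : sgraph) :
  contracts G H -> exists f : G -> H, contraction_map f.
Proof.
elim=> [|{}H x y _ [f f_contr] xy].
  by exists id; apply: bijective_contraction_map => //; exists id.
exists (contract_map x y \o f).
exact: contraction_map_comp f_contr (contract_contraction_map xy).
Qed.

Lemma contracts_trans (G H K : sgraph) :
  contracts G H -> contracts H K -> contracts G K.
Proof. by move=> GH; elim=> // L x y _ GL xy; apply: contracts_step. Qed.

Lemma contraction_map_contracts (G H : sgraph) (f : G -> H) :
  contraction_map f -> exists H', contracts G H' /\ sg_iso H' H.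
Proof.
have [n] := ubnP #|G|; elim: n => // n IHn in G f * => leGn f_contr.
have [f_inj|f_ninj] := pselect (injective f).
  exists G; split; first exact: contracts_refl.
  exact: injective_contraction_map_iso f_inj.
have [x [y [xy eq_f]]] := contraction_map_collapse f_contr f_ninj.
pose g (u : contract x y) := if u is Some z then f (val z) else f x.
have fE : g \o contract_map x y = f.
  apply: funext => z; rewrite /= /contract_map.
  case: insubP => [u _ <- //|/negPn] /=.
  by rewrite !inE => /orP[]/eqP ->.
have g_contr : contraction_map g.
  by apply: contraction_map_factor (contract_contraction_map xy) _; rewrite fE.
have [H' [contracts_H' iso_H']] :=
  IHn _ g (leq_trans (card_contract xy) leGn) g_contr.
exists H'; split=> //; apply: contracts_trans contracts_H'.
exact: contracts_step (contracts_refl G) xy.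
Qed.

Lemma contracts_isoP (G H : sgraph) :
  (exists H', contracts G H' /\ sg_iso H' H) <->
  exists f : G -> H, contraction_map f.
Proof.
split=> [[H' [/contracts_contraction_map[f f_contr] [g [g_bij g_mono]]]]|[f]].
  exists (g \o f); apply: contraction_map_comp f_contr _.
  exact: bijective_contraction_map.
exact: contraction_map_contracts.
Qed.

Lemma minor_contraction_mapP (M G : sgraph) :
  minor M G <->
  exists (S : subgraph G) (f : graph_of_subgraph S -> M), contraction_map f.
Proof. by split=> -[S /contracts_isoP]; exists S. Qed.

(** * Minor maps *)

(* The fibre over [Some u] is the branch set of [u]; the vertices sent to
   [None] are deleted. *)
Definition minor_map (G M : sgraph) (f : G -> option M) : Prop :=
  [/\ forall u, exists x, f x = Some u,
      forall u, connected (f @^-1: [set Some u]) &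
      forall u v, u -- v -> adjacent_fibres f (Some u) (Some v)].

Lemma minor_minor_map (M G : sgraph) :
  minor M G -> exists f : G -> option M, minor_map f.
Proof.
case/minor_contraction_mapP=> S [f [f_surj f_conn _ f_lift]].
pose F (x : G) : option M := omap f (insub x : option (graph_of_subgraph S)).
have FE (u : graph_of_subgraph S) : F (val u) = Some (f u) by rewrite /F valK.
exists F; split=> [m|m|m n].
- by have [u <-] := f_surj m; exists (val u).
- have -> : F @^-1: [set Some m] = [set val u | u in f @^-1: [set m]].
    apply/setP=> x; rewrite !inE; apply/eqP/imsetP => [|[u + ->]].
      rewrite /F; case: insubP => //= u _ <- [fu].
      by exists u; rewrite // !inE fu.
    by rewrite FE !inE => /eqP ->.
  apply: (@connected_imset (graph_of_subgraph S)) (f_conn m) => u v uv.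
  by right; apply: sub_edge_sub uv.
- case/f_lift=> u [v [<- <- uv]]; exists (val u), (val v).
  by rewrite !FE; split=> //; apply: sub_edge_sub uv.
Qed.

Section MinorSubgraph.
Variables (G M : sgraph) (f : G -> option M).

Definition minor_subgraph_edge : rel G := fun x y =>
  (x -- y) &&
  (if (f x, f y) is (Some u, Some v) then (u == v) || (u -- v) else false).

Lemma minor_subgraph_edge_sym : symmetric minor_subgraph_edge.
Proof.
move=> x y; rewrite /minor_subgraph_edge sedge_sym.
by case: (f x) (f y) => [u|] [v|] //; rewrite eq_sym (sedge_sym u).
Qed.

Lemma minor_subgraph_edge_sub : subrel minor_subgraph_edge (@sedge G).
Proof. by move=> x y /andP[]. Qed.

Definition minor_subgraph : subgraph G :=
  Subgraph [set x | f x] minor_subgraph_edge_sym minor_subgraph_edge_sub.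

Lemma minor_map_minor : minor_map f -> minor M G.
Proof.
move=> [f_surj f_conn f_lift].
apply/minor_contraction_mapP; exists minor_subgraph.
have /fin_all_exists[g gE] (x : graph_of_subgraph minor_subgraph) :
    exists u, f (val x) = Some u.
  by case: x => x /=; rewrite inE; case: (f x) => // u _; exists u.
have val_onto x u : f x = Some u ->
    exists2 y : graph_of_subgraph minor_subgraph, val y = x & g y = u.
  move=> fx; have xS : x \in sub_verts minor_subgraph by rewrite inE fx.
  by exists (Sub x xS) => //; have := gE (Sub x xS); rewrite /= fx => -[].
have edgeE (x y : graph_of_subgraph minor_subgraph) :
    (x -- y) = (val x -- val y) && ((g x == g y) || (g x -- g y)).
  by rewrite [LHS]/= /graph_of_subgraph_rel /= /minor_subgraph_edge !gE.
exists g; split=> [u|u|x y|u v uv].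
- by have [x /val_onto[y _ gy]] := f_surj u; exists y.
- have -> : g @^-1: [set u] = val @^-1: (f @^-1: [set Some u]).
    by apply/setP=> y; rewrite !inE gE.
  apply: (@connected_preimset (graph_of_subgraph minor_subgraph)) (f_conn u).
    by move=> x _; apply: connected_fibre_inj; apply: val_inj.
  move=> a b; rewrite !inE => /eqP fa /eqP fb ab.
  have [[a' va ga] [b' vb gb]] := (val_onto _ _ fa, val_onto _ _ fb).
  by exists a', b'; split=> //; rewrite edgeE va vb ab ga gb eqxx.
- by rewrite edgeE => /andP[_ /orP[/eqP|]]; [left|right].
- have [a [b [/val_onto[a' va ga] /val_onto[b' vb gb] ab]]] := f_lift u v uv.
  by exists a', b'; split=> //; rewrite edgeE va vb ab ga gb uv orbT.
Qed.

End MinorSubgraph.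

Lemma minorP (M G : sgraph) :
  minor M G <-> exists f : G -> option M, minor_map f.
Proof. by split=> [/minor_minor_map|[f /minor_map_minor]]. Qed.

Section Relabel.
Variables (G M N : sgraph) (f : G -> option M) (g : N -> M).
Hypothesis g_inj : injective g.

Definition relabel (x : G) : option N := [pick u | f x == Some (g u)].

Lemma relabel_eq (x : G) (u : N) : (relabel x == Some u) = (f x == Some (g u)).
Proof.
rewrite /relabel; case: pickP => [v /eqP ->|no_u]; last by rewrite no_u.
by apply/eqP/eqP => [[->]|[/g_inj ->]].
Qed.

Lemma minor_map_relabel :
  {homo g : u v / u -- v >-> u -- v} -> minor_map f -> minor_map relabel.
Proof.
move=> g_homo [f_surj f_conn f_lift].
split=> [u|u|u v /g_homo/f_lift[x [y [fx fy xy]]]].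
- by have [x fx] := f_surj (g u); exists x; apply/eqP; rewrite relabel_eq fx.
- have -> : relabel @^-1: [set Some u] = f @^-1: [set Some (g u)].
    by apply/setP=> x; rewrite !inE relabel_eq.
  exact: f_conn.
- by exists x, y; split=> //; apply/eqP; rewrite relabel_eq ?fx ?fy.
Qed.

End Relabel.

Lemma minor_map_restrict (G K M : sgraph) (i : G -> K) (f : K -> option M) :
  injective i -> {mono i : x y / x -- y >-> x -- y} ->
  (forall c, f c -> c \in codom i) -> minor_map f -> minor_map (f \o i).
Proof.
move=> i_inj i_mono f_supp [f_surj f_conn f_lift].
have onto c u : f c = Some u -> exists x, i x = c.
  by move=> fc; have /f_supp/codomP[x ->] : f c by [rewrite fc]; exists x.
split=> [u|u|u v /f_lift[c [d [fc fd cd]]]].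
- have [c fc] := f_surj u; have [x ix] := onto c u fc.
  by exists x; rewrite /= ix.
- have -> : (f \o i) @^-1: [set Some u] = i @^-1: (f @^-1: [set Some u]).
    by apply/setP=> x; rewrite !inE.
  apply: connected_preimset (f_conn u) => [c _|c d].
    exact: connected_fibre_inj.
  rewrite !inE => /eqP/onto[x <-] /eqP/onto[y <-]; rewrite i_mono.
  by exists x, y.
- have [[x ix] [y iy]] := (onto c u fc, onto d v fd).
  by exists x, y; rewrite /= -i_mono ix iy.
Qed.

(** * Deleted vertices and universal vertices *)

Lemma hadwiger_number_minor (G : sgraph) :
  minor (complete (hadwiger_number G)) G.
Proof. by rewrite /hadwiger_number; case: ex_maxnP => t /asboolP. Qed.

Lemma leq_hadwiger_number (G : sgraph) (t : nat) :
  minor (complete t) G -> t <= hadwiger_number G.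
Proof.
by move/asboolP; rewrite /hadwiger_number; case: ex_maxnP => s _; apply.
Qed.

Lemma complete_minor_delete (G K : sgraph) (i : G -> K) (t : nat) :
  injective i -> {mono i : x y / x -- y >-> x -- y} -> minor (complete t) K ->
  exists2 s, minor (complete s) G & t <= s + #|[predC codom i]|.
Proof.
move=> i_inj i_mono /minorP[f f_minor].
pose hit := [set u : 'I_t | Some u \in f @: [predC codom i]].
pose g (u : complete #|~: hit|) : complete t := enum_val u.
exists #|~: hit|.
  apply/minorP; exists (relabel f g \o i).
  apply: minor_map_restrict => // [c|].
    rewrite /relabel; case: pickP => // u /eqP fc _; apply: contraT => cN.
    by have := enum_valP u; rewrite !inE -/(g u) -fc imset_f.
  apply: minor_map_relabel f_minor; first exact: enum_val_inj.
  by move=> u v; rewrite /= /complete_rel (inj_eq enum_val_inj).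
rewrite -[X in X <= _]card_ord -(cardsC hit) addnC leq_add2l.
rewrite -(card_imset hit (@Some_inj _)); apply: leq_trans (leq_imset_card f _).
by apply/subset_leq_card/subsetP => _ /imsetP[u + ->]; rewrite inE.
Qed.

Lemma hadwiger_number_delete (G K : sgraph) (i : G -> K) :
  injective i -> {mono i : x y / x -- y >-> x -- y} ->
  hadwiger_number K <= hadwiger_number G + #|[predC codom i]|.
Proof.
move=> i_inj i_mono.
have [s /leq_hadwiger_number le_s le_t] :=
  complete_minor_delete i_inj i_mono (hadwiger_number_minor K).
by apply: leq_trans le_t _; rewrite leq_add2r.
Qed.

Lemma chromatic_number_coloring (G : sgraph) :
  exists h : G -> 'I_(chromatic_number G), forall x y, x -- y -> h x != h y.
Proof.
rewrite /chromatic_number; case: ex_minnP => k /existsP[h /forallP h_col] _.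
by exists h => x y; have /forallP/(_ y)/implyP := h_col x.
Qed.

Lemma leq_chromatic_number (G : sgraph) (C : finType) (h : G -> C) :
  (forall x y, x -- y -> h x != h y) -> chromatic_number G <= #|C|.
Proof.
move=> h_col; rewrite /chromatic_number; case: ex_minnP => k _; apply.
apply/existsP; exists [ffun x => enum_rank (h x)].
apply/forallP=> x; apply/forallP=> y; apply/implyP=> /h_col.
by rewrite !ffunE (inj_eq enum_rank_inj).
Qed.

Lemma chromatic_number_universal (G K : sgraph) (i : G -> K) :
  {homo i : x y / x -- y >-> x -- y} ->
  (forall c x, c \notin codom i -> x != c -> x -- c) ->
  chromatic_number G + #|[predC codom i]| <= chromatic_number K.
Proof.
move=> i_homo i_univ; have [h h_col] := chromatic_number_coloring K.
have h_univ c x : c \notin codom i -> h x = h c -> x = c.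
  move=> cN hxc; apply/eqP; apply: contraT => /(i_univ c x cN)/h_col.
  by rewrite hxc eqxx.
have h_inj : {in [predC codom i] &, injective h}.
  by move=> c d _; rewrite inE; apply: h_univ.
pose colours := h @: [predC codom i].
have h_free x : h (i x) \notin colours.
  apply/imsetP => -[c]; rewrite inE => cN /(h_univ c _ cN) ixc.
  by rewrite -ixc codom_f in cN.
have le_G : chromatic_number G <= #|{: {u | u \notin colours}}|.
  pose col x : {u | u \notin colours} := Sub (h (i x)) (h_free x).
  by apply: (@leq_chromatic_number _ _ col) => x y /i_homo/h_col.
rewrite -[X in _ <= X]card_ord -(cardC [in colours]) addnC.
by rewrite -(card_in_imset h_inj) leq_add2l card_sig in le_G *.
Qed.

(** * Squares of split graphs *)

Lemma walk_of_length0E (G : sgraph) (x y : G) : walk_of_length 0 x y = (x == y).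
Proof. by apply/existsP/idP => [[p]|xy]; [rewrite tuple0 | exists [tuple]]. Qed.

Lemma walk_of_lengthSE (G : sgraph) (d : nat) (x y : G) :
  walk_of_length d.+1 x y = [exists z, (x -- z) && walk_of_length d z y].
Proof.
apply/existsP/existsP => [[p]|[z /andP[xz /existsP[p zp]]]].
  case/tupleP: p => z p /=; rewrite -andbA => /andP[xz zp].
  by exists z; rewrite xz; apply/existsP; exists p.
by exists [tuple of z :: p]; rewrite /= xz.
Qed.

Lemma walk_of_length1E (G : sgraph) (x y : G) : walk_of_length 1 x y = (x -- y).
Proof.
rewrite walk_of_lengthSE; apply/existsP/idP => [[z]|xy].
  by rewrite walk_of_length0E => /andP[xz /eqP <-].
by exists y; rewrite xy walk_of_length0E eqxx.
Qed.

Lemma squareE (G : sgraph) (x y : G) :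
  square_rel x y = (x != y) && ((x -- y) || [exists z, (x -- z) && (z -- y)]).
Proof.
rewrite /square_rel; have [//|neq_xy] /= := eqVneq x y.
have dist1 : at_distance 1 x y = (x -- y).
  rewrite /at_distance walk_of_length1E andb_idr // => _.
  by apply/forallP => -[[|//] j]; rewrite /= walk_of_length0E.
rewrite dist1; have [//|not_xy] /= := boolP (x -- y).
have walk2 : walk_of_length 2 x y = [exists z, (x -- z) && (z -- y)].
  by rewrite walk_of_lengthSE; apply: eq_existsb => z; rewrite walk_of_length1E.
rewrite /at_distance walk2 andb_idr // => _.
by apply/forallP => -[[|[|//]] j];
  rewrite /= ?walk_of_length0E ?walk_of_length1E.
Qed.

Section SplitOf.
Variables (V E : finType) (inc : V -> E -> bool).

Definition split_of_rel : rel (V + E) := fun u v =>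
  match u, v with
  | inl _, inl _ => false
  | inl x, inr e | inr e, inl x => inc x e
  | inr e, inr e' => e != e'
  end.

Lemma split_of_sym : symmetric split_of_rel.
Proof. by move=> [x|e] [y|e'] //=; rewrite eq_sym. Qed.

Lemma split_of_irrefl : irreflexive split_of_rel.
Proof. by move=> [x|e] //=; rewrite eqxx. Qed.

Definition split_of : sgraph := SGraph split_of_sym split_of_irrefl.

Lemma split_of_split : split_graph split_of.
Proof.
exists [set u : split_of | if u is inl _ then true else false].
by split=> [[x|e] [y|e']|[x|e] [y|e']]; rewrite !inE.
Qed.

Lemma square_split_of_inl (x y : V) :
  @sedge (square split_of) (inl x) (inl y) =
    (x != y) && [exists e, inc x e && inc y e].
Proof.
rewrite [LHS]squareE /=; congr (_ && _).
apply/existsP/existsP => [[[//|e] xey]|[e xey]]; first by exists e.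
by exists (inr e).
Qed.

Lemma square_split_of_inr (e : E) (u : square split_of) :
  (forall x, exists e, inc x e) -> u != inr e -> u -- inr e.
Proof.
move=> inc_total neq_ue; rewrite /= squareE neq_ue /=.
case: u neq_ue => [x|e'] /= neq_ue; last by rewrite neq_ue.
have [//|not_xe] /= := boolP (inc x e); have [e' xe'] := inc_total x.
apply/existsP; exists (inr e'); rewrite /= xe' /=.
by apply: contraNneq not_xe => <-.
Qed.

End SplitOf.

Definition incident (G : sgraph) (x : G) (p : G * G) : bool :=
  ((p.1 == p.2) || (p.1 -- p.2)) && (x \in [set p.1; p.2]).

Lemma incident_diag (G : sgraph) (x : G) : incident x (x, x).
Proof. by rewrite /incident /= eqxx set21. Qed.

Lemma common_incident (G : sgraph) (x y : G) :
  (x != y) && [exists p, incident x p && incident y p] = (x -- y).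
Proof.
apply/andP/idP => [[neq_xy /existsP[[a b]]]|xy].
  rewrite /incident !inE /= => /andP[/andP[ab xp] /andP[_ yp]].
  case/orP: xp neq_xy => /eqP ->; case/orP: yp => /eqP -> neq_xy;
    rewrite ?eqxx // in neq_xy *.
  - by case/orP: ab neq_xy => [/eqP ->|//]; rewrite eqxx.
  - by rewrite sedge_sym; case/orP: ab neq_xy => [/eqP ->|//]; rewrite eqxx.
split; first by apply: contraTneq xy => ->; rewrite sedge_irrefl.
by apply/existsP; exists (x, y); rewrite /incident /= xy set21 set22 orbT.
Qed.

Theorem theorem1 :
  (forall G : sgraph, hadwiger_number G >= chromatic_number G) <->
  (forall H : sgraph, split_graph H ->
     hadwiger_number (square H) >= chromatic_number (square H)).
Proof.
split=> [hadwiger H _|hadwiger_split G]; first exact: hadwiger.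
pose H := split_of (@incident G); pose i (x : G) : square H := inl x.
have i_inj : injective i by move=> x y [].
have i_mono : {mono i : x y / x -- y >-> x -- y}.
  by move=> x y; rewrite square_split_of_inl common_incident.
have i_univ c u : c \notin codom i -> u != c -> u -- c.
  case: c => [x|p] cN; first by rewrite codom_f in cN.
  by apply: square_split_of_inr => x; exists (x, x); apply: incident_diag.
rewrite -(leq_add2r #|[predC codom i]|).
apply: leq_trans (hadwiger_number_delete i_inj i_mono).
apply: leq_trans (hadwiger_split H (split_of_split _)).
by apply: chromatic_number_universal i_univ => x y; rewrite i_mono.
Qed.
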